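(* Let $S$ be an idempotent semifield, let $n\geq 1$, and let $U_n(S)$ be the monoid of unitriangular matrices, that is, upper triangular $n\times n$ matrices over $S$ with all diagonal entries equal to $\mathbf{1}$, under matrix multiplication. Then $U_n(S)$ is Fountain, and each $\widetilde{\mathcal{R}}$-class and each $\widetilde{\mathcal{L}}$-class contains a unique idempotent: for $A\in U_n(S)$ the unique idempotent in its $\widetilde{\mathcal{R}}$-class is $A^{(+)}$ and the unique idempotent in its $\widetilde{\mathcal{L}}$-class is $A^{( * )}$.
   Context: An idempotent semifield is a commutative semiring $S$ with $x+x=x$ for all $x$, in which $S^*=S\setminus\{\mathbf{0}\}$ is an abelian group under multiplication with identity $\mathbf{1}$. The natural order is $a\leq b\iff a+b=b$; with it $S^*$ is a lattice ordered abelian group, $\mathbf{0}$ is the least element of $S$, and addition is least upper bound; $\bigwedge$ denotes greatest lower bound. For $x\in S^n$, $\mathrm{Supp}(x)$ is the set of indices of non-zero entries of $x$, and $A_{i,\star}$ is the $i$th row of $A$. For an $n\times n$ matrix $A$ over $S$ the matrix $A^{(+)}$ is defined by $$(A^{(+)})_{i,j}=\begin{cases}\bigwedge\{A_{i,k}A_{j,k}^{-1}: k\in\mathrm{Supp}(A_{j,\star})\} & \text{if } \emptyset\neq\mathrm{Supp}(A_{j,\star})\subseteq\mathrm{Supp}(A_{i,\star}),\\ \mathbf{0} & \text{otherwise.}\end{cases}$$ For upper triangular $X$, $\Delta(X)_{i,j}=X_{n-j+1,n-i+1}$ (reflection in the anti-diagonal), and $A^{( * )}:=\Delta\big((\Delta(A))^{(+)}\big)$.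 For a semigroup $T$: $a\,\widetilde{\mathcal{R}}\,b$ iff for all idempotents $e\in T$, $ea=a\Leftrightarrow eb=b$; $a\,\widetilde{\mathcal{L}}\,b$ iff for all idempotents $e\in T$, $ae=a\Leftrightarrow be=b$. $T$ is Fountain if every $\widetilde{\mathcal{R}}$-class and every $\widetilde{\mathcal{L}}$-class of $T$ contains an idempotent. *)

(* Defs.v *)
From HB Require Import structures.
From mathcomp Require Import all_boot all_order all_algebra.
From mathcomp Require Import boolp classical_sets.

Set Implicit Arguments.
Unset Strict Implicit.
Unset Printing Implicit Defensive.

Import Order.Theory GRing.Theory.
Local Open Scope ring_scope.

(* [1 != 0] is part of [GRing.ComNzSemiRing]; closure of the non-zero elements
   under multiplication follows from [mulVsf].  The value of [sfinv] at 0 is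
   unconstrained and is never used below. *)
HB.mixin Record isIdemSemifield S of GRing.ComNzSemiRing S := {
  addss : forall x : S, x + x = x;
  sfinv : S -> S;
  mulVsf : forall x : S, x != 0 -> sfinv x * x = 1
}.

#[short(type="idemSemifieldType")]
HB.structure Definition IdemSemifield :=
  {S of isIdemSemifield S & GRing.ComNzSemiRing S}.

(* An alias of [S] that carries the natural order [a <= b <-> a + b = b]. *)
Definition natord (S : idemSemifieldType) : Type := S.

Fact natord_display : Order.disp_t. Proof. exact: (Order.Disp tt tt). Qed.

Section NaturalOrder.
Variable S : idemSemifieldType.

Definition natle (a b : S) : bool := a + b == b.

Lemma natle_refl : reflexive natle.
Proof. by move=> x; rewrite /natle addss. Qed.

Lemma natle_anti : antisymmetric natle.
Proof. by move=> x y /andP[/eqP xy /eqP yx]; rewrite -xy addrC yx. Qed.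

Lemma natle_trans : transitive natle.
Proof.
by move=> y x z /eqP xy /eqP yz; rewrite /natle -yz addrA xy.
Qed.

HB.instance Definition _ := Choice.on (natord S).
HB.instance Definition _ := Order.Le_isPOrder.Build
  natord_display (natord S) natle_refl natle_anti natle_trans.

(* [infimum] takes its first argument 0 on the empty set and where no greatest
   lower bound exists; by [infimums_quot] below neither case occurs in
   [mxplus]. *)
Definition glb (X : set S) : S := @infimum _ (natord S) (0 : S) X.

End NaturalOrder.

Section PlusStar.
Variables (S : idemSemifieldType) (n : nat).
Implicit Types A : 'M[S]_n.

Definition supp (x : 'rV[S]_n) : {set 'I_n} := [set k | x 0%R k != 0]%SET.

Definition mxplus A : 'M[S]_n :=
  \matrix_(i, j)
    if (supp (row j A) != finset.set0) && (supp (row j A) \subset supp (row i A))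
    then glb [set A i k * sfinv (A j k) | k in [set` supp (row j A)]]%classic
    else 0.

Definition antidiag A : 'M[S]_n := \matrix_(i, j) A (rev_ord j) (rev_ord i).

Definition mxstar A : 'M[S]_n := antidiag (mxplus (antidiag A)).

Definition is_unitri A : bool :=
  [forall i : 'I_n, forall j : 'I_n, (j < i)%N ==> (A i j == 0)]
  && [forall i, A i i == 1].

Lemma is_unitriP A :
  reflect ((forall i j : 'I_n, (j < i)%N -> A i j = 0) /\ (forall i, A i i = 1))
          (is_unitri A).
Proof.
apply: (iffP andP) => [[/forallP U /forallP D]|[U D]]; split.
- by move=> i j ji; apply/eqP; move: (forallP (U i) j) ji => /implyP; apply.
- by move=> i; apply/eqP.
- by apply/forallP => i; apply/forallP => j; apply/implyP => /U->.
- by apply/forallP => i; rewrite D.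
Qed.

Lemma is_unitri1 : is_unitri (1%:M).
Proof.
apply/is_unitriP; split=> [i j ji|i]; rewrite mxE ?eqxx//.
by case: eqP ji => // ->; rewrite ltnn.
Qed.

Lemma is_unitriM A B : is_unitri A -> is_unitri B -> is_unitri (A *m B).
Proof.
move=> /is_unitriP[UA DA] /is_unitriP[UB DB]; apply/is_unitriP; split.
  move=> i j ji; rewrite mxE big1// => k _; have [ki|ik] := ltnP k i.
    by rewrite UA ?mul0r.
  by rewrite UB ?mulr0// (leq_trans ji).
move=> i; rewrite mxE (bigD1 i)//= DA DB mul1r big1 ?addr0// => k ki.
by case: (ltngtP k i) ki => [h|h|/val_inj->];
  rewrite ?eqxx// ?(UA _ _ h) ?(UB _ _ h) ?mul0r ?mulr0.
Qed.

Record unitri := Unitri { unitri_mx :> 'M[S]_n; _ : is_unitri unitri_mx }.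

HB.instance Definition _ := [isSub for unitri_mx].
HB.instance Definition _ := [Choice of unitri by <:].

Definition unitri_one : unitri := Unitri is_unitri1.
Definition unitri_mul (A B : unitri) : unitri :=
  Unitri (is_unitriM (valP A) (valP B)).

Lemma unitri_mulA : associative unitri_mul.
Proof. by move=> A B C; apply: val_inj; rewrite /= mulmxA. Qed.

Lemma unitri_mul1 : left_id unitri_one unitri_mul.
Proof. by move=> A; apply: val_inj; rewrite /= mul1mx. Qed.

Lemma unitri_1mul : right_id unitri_one unitri_mul.
Proof. by move=> A; apply: val_inj; rewrite /= mulmx1. Qed.

HB.instance Definition _ :=
  isMonoid.Build unitri unitri_mulA unitri_mul1 unitri_1mul.

End PlusStar.

Section Fountain.
Variable T : semigroupType.
Local Open Scope group_scope.
Implicit Types a b e : T.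

Definition idem e : Prop := e * e = e.

Definition Rtilde a b : Prop := forall e, idem e -> (e * a = a <-> e * b = b).

Definition Ltilde a b : Prop := forall e, idem e -> (a * e = a <-> b * e = b).

Definition Fountain : Prop :=
  (forall a, exists e, idem e /\ Rtilde a e) /\
  (forall a, exists e, idem e /\ Ltilde a e).

End Fountain.

Section Infima.
Variable S : idemSemifieldType.
Implicit Types x y z : S.

Lemma mulsf_neq0 x y : x != 0 -> y != 0 -> x * y != 0.
Proof.
move=> x0; apply: contra_neq => xy0.
by rewrite -[y]mul1r -(mulVsf _ x0) -mulrA xy0 mulr0.
Qed.

Lemma sfinv_neq0 x : x != 0 -> sfinv x != 0.
Proof.
by move=> /mulVsf; case: eqP => // -> /eqP; rewrite mul0r eq_sym oner_eq0.
Qed.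

Lemma natle_mul z x y : natle x y -> natle (z * x) (z * y).
Proof. by move=> /eqP xy; rewrite /natle -mulrDr xy. Qed.

Lemma natle_inv x y : x != 0 -> y != 0 -> natle x y -> natle (sfinv y) (sfinv x).
Proof.
move=> x0 y0 /(natle_mul (sfinv x * sfinv y)).
by rewrite mulrAC mulVsf// mul1r -mulrA mulVsf// mulr1.
Qed.

Lemma sfinvK x : x != 0 -> sfinv (sfinv x) = x.
Proof.
move=> x0; rewrite -[LHS]mulr1 -(mulVsf _ x0) mulrA mulVsf ?mul1r//.
exact: sfinv_neq0.
Qed.

Lemma natle_sum (I : finType) (P : {set I}) (F : I -> S) i :
  i \in P -> natle (F i) (\sum_(k in P) F k).
Proof. by move=> iP; rewrite (bigD1 i)//= /natle addrA addss. Qed.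

Lemma sum_natle (I : finType) (P : {set I}) (F : I -> S) y :
  (forall i, i \in P -> natle (F i) y) -> natle (\sum_(k in P) F k) y.
Proof.
move=> Fy; elim/big_ind: _ => //; first by rewrite /natle add0r.
by move=> a b /eqP ay /eqP b_y; rewrite /natle -addrA b_y ay.
Qed.

Lemma infimums_fin (I : finType) (P : {set I}) (F : I -> S) :
  P != finset.set0 -> (forall i, i \in P -> F i != 0) ->
  infimums ([set F k | k in [set` P]]%classic : set (natord S))
    (sfinv (\sum_(k in P) sfinv (F k))).
Proof.
move=> /finset.set0Pn[i0 i0P] F0; set s := \sum_(k in P) _.
have nz x y : x != 0 -> natle x y -> y != 0.
  by move=> x0; apply: contraTneq => ->; rewrite /natle addr0.
have s0 : s != 0.
  apply: (nz (sfinv (F i0))); first exact/sfinv_neq0/F0.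
  exact: (natle_sum (fun k => sfinv (F k))).
split=> [_ [i /= iP <-]|y yF].
  change (is_true (natle (sfinv s) (F i))).
  rewrite -[X in natle _ X]sfinvK ?F0//; apply: natle_inv => //.
    exact/sfinv_neq0/F0.
  exact: (natle_sum (fun k => sfinv (F k))).
change (is_true (natle y (sfinv s))).
have [->|y0] := eqVneq y (0 : S); first by rewrite /natle add0r.
rewrite -[y]sfinvK//; apply: natle_inv => //; first exact: sfinv_neq0.
apply: sum_natle => i iP; apply: natle_inv => //; first exact: F0.
by apply: (yF (F i)); exists i.
Qed.

Lemma infimums_quot n (A : 'M[S]_n) (i j : 'I_n) :
  supp (row j A) != finset.set0 -> supp (row j A) \subset supp (row i A) ->
  infimums ([set A i k * sfinv (A j k) | k in [set` supp (row j A)]]%classic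
              : set (natord S))
    (sfinv (\sum_(k in supp (row j A)) sfinv (A i k * sfinv (A j k)))).
Proof.
move=> j0 /fintype.subsetP ji; apply: infimums_fin; first exact: j0.
move=> k kj; have := ji k kj; move: kj; rewrite !finset.inE !mxE => jk ik.
by apply: mulsf_neq0 => //; apply: sfinv_neq0.
Qed.

Lemma glb_infimums (X : set S) (y : S) :
  (X !=set0)%classic -> infimums (X : set (natord S)) y -> glb X = y.
Proof.
move=> /set0P/negPf X0 Xy; rewrite /glb /infimum X0.
by apply: xget_unique => // z Xz; apply: is_subset1_infimums Xz Xy.
Qed.

End Infima.

(* Main.v *)
Require Import Defs.
From HB Require Import structures.
From mathcomp Require Import all_boot all_order all_algebra.
From mathcomp Require Import boolp classical_sets.

(** Order matrices entrywise by the natural order of [S].  The whole argument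
    rests on a residuation: when no row of [A] vanishes, [A^(+)] is the
    greatest matrix [X] with [X A <= A] ([mulmx_le_mxplus]), because [A^(+)_ij]
    is the greatest [x] with [x A_jk <= A_ik] for all [k].

    A unitriangular matrix lies above the identity, so [A <= X A] for
    unitriangular [X] and the equation [X A = A] says exactly [X <= A^(+)].
    Write [P = A^(+)]; it is unitriangular, hence [P A = A].  From [P P A = A]
    one gets [P P <= P], so [P] is idempotent, and then [X P = P] is again
    equivalent to [X <= P]; thus [P] and [A] have the same left identities.  If
    [F] is another idempotent with the same left identities as [A], then
    [F A = A] gives [F <= P], while [P F = F] gives [P <= F].

    The statement for [Ltilde] follows by symmetry: reflection
    in the anti-diagonal is an involutive anti-automorphism of the monoid of
    unitriangular matrices, so it exchanges the two relations
    ([Ltilde_antidiag]). *)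

Set Implicit Arguments.
Unset Strict Implicit.
Unset Printing Implicit Defensive.

Import GRing.Theory.
Local Open Scope ring_scope.

Section Residuation.
Variable S : idemSemifieldType.
Implicit Types x a b : S.

Lemma natle0 x : natle x 0 = (x == 0).
Proof. by rewrite /natle addr0. Qed.

Lemma natle_quot x a b : a != 0 -> natle x (b * sfinv a) = natle (x * a) b.
Proof.
move=> a0; apply/idP/idP => [/(natle_mul a)|/(natle_mul (sfinv a))].
  by rewrite mulrC [a * _]mulrC -mulrA mulVsf// mulr1.
by rewrite [x * a]mulrC mulrA mulVsf// mul1r mulrC.
Qed.

(** The indices [k] with [A_jk = 0] impose no condition on the right, and on
    the others the condition reads [x <= A_ik A_jk^-1]; so this is the
    definition of the greatest lower bound, which exists because the row is
    non-zero.  When the supports are not nested, an index [k] with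
    [A_jk != 0 = A_ik] forces [x = 0], in accordance with the value [0] chosen
    for [A^(+)_ij]. *)
Lemma natle_mxplus n (A : 'M[S]_n) i j x : supp (row j A) != finset.set0 ->
  natle x (mxplus A i j) <-> forall k, natle (x * A j k) (A i k).
Proof.
move=> j0; rewrite mxE j0 /=.
have suppE k (l : 'I_n) : (k \in supp (row l A)) = (A l k != 0).
  by rewrite finset.inE mxE.
case: ifPn => [ji|/fintype.subsetPn[k]]; last first.
  rewrite !suppE negbK => jk0 /eqP ik0; split=> [|/(_ k)].
    by rewrite natle0 => /eqP-> l; rewrite mul0r /natle add0r.
  by rewrite ik0 !natle0; apply: contraTT => x0; apply: mulsf_neq0.
have inf := infimums_quot j0 ji.
rewrite (glb_infimums _ inf); last first.
  by have /finset.set0Pn[k kj] := j0; exists (A i k * sfinv (A j k)), k.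
case: inf => lb greatest; split=> [xy k|xA].
  have [->|jk0] := eqVneq (A j k) 0; first by rewrite mulr0 /natle add0r.
  rewrite -natle_quot//; apply: natle_trans xy _.
  by apply: lb; exists k => //=; rewrite suppE.
apply: greatest => _ [k /= kj <-].
(* [greatest] speaks of the order of [natord S], which is [natle] on [S]. *)
change (is_true (natle x (A i k * sfinv (A j k)))).
by rewrite natle_quot// -suppE.
Qed.

End Residuation.

Section MatrixOrder.
Variables (S : idemSemifieldType) (n : nat).
Implicit Types A B X Y E : 'M[S]_n.

Definition mxle X Y : Prop := X + Y = Y.

Lemma mxleP X Y : mxle X Y <-> forall i j, natle (X i j) (Y i j).
Proof.
split=> [XY i j|XY]; first by rewrite /natle -{2}XY mxE.
by apply/matrixP => i j; rewrite mxE; apply/eqP/XY.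
Qed.

Lemma mxle_anti X Y : mxle X Y -> mxle Y X -> X = Y.
Proof. by move=> XY YX; rewrite -XY addrC YX. Qed.

Lemma mxle_mul2l A X Y : mxle X Y -> mxle (A *m X) (A *m Y).
Proof. by move=> XY; rewrite /mxle -mulmxDr XY. Qed.

Lemma mxle_mul2r A X Y : mxle X Y -> mxle (X *m A) (Y *m A).
Proof. by move=> XY; rewrite /mxle -mulmxDl XY. Qed.

Lemma mxle_refl X : mxle X X.
Proof. by apply/mxleP => i j; apply: natle_refl. Qed.

(** Sums are least upper bounds, so an inequality on a product of matrices is
    an inequality on each of its terms. *)
Lemma mulmx_leP X A B :
  mxle (X *m A) B <-> forall i j k, natle (X i j * A j k) (B i k).
Proof.
have mulE i k : (X *m A) i k = \sum_(l in finset.setT) X i l * A l k.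
  by rewrite mxE; apply: eq_bigl => l; rewrite finset.in_setT.
split=> [/mxleP XAB i j k|XAB].
  apply: natle_trans (XAB i k); rewrite mulE.
  by apply: (natle_sum (fun l => X i l * A l k)); rewrite finset.in_setT.
by apply/mxleP => i k; rewrite mulE; apply: sum_natle.
Qed.

(** Residuation: right multiplication by [A] is a monotone map of matrices,
    and [natle_mxplus] computes its adjoint at [A] entry by entry. *)
Lemma mulmx_le_mxplus X A : (forall j, supp (row j A) != finset.set0) ->
  mxle (X *m A) A <-> mxle X (mxplus A).
Proof.
move=> A0; rewrite mulmx_leP mxleP.
by split=> XA i j; [apply/natle_mxplus | apply/natle_mxplus/XA].
Qed.

Lemma unitri_supp A j : is_unitri A -> supp (row j A) != finset.set0.
Proof.
move=> /is_unitriP[_ A1]; apply/finset.set0Pn; exists j.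
by rewrite finset.inE mxE A1 oner_eq0.
Qed.

Lemma unitri_ge1 E : is_unitri E -> mxle 1%:M E.
Proof.
move=> /is_unitriP[_ E1]; apply/mxleP => i j; rewrite mxE.
by case: eqP => [<-|_]; rewrite /natle ?E1 ?addss ?add0r.
Qed.

Lemma unitri_mulmx_ge E A : is_unitri E -> mxle A (E *m A).
Proof. by move=> /unitri_ge1/(mxle_mul2r A); rewrite mul1mx. Qed.

(** As [A <= E A] always holds here, the equation [E A = A] is as good as an
    inequality, to which residuation applies. *)
Lemma unitri_fix_mxplus E A : is_unitri E -> is_unitri A ->
  E *m A = A <-> mxle E (mxplus A).
Proof.
move=> uE uA; rewrite -mulmx_le_mxplus; last by move=> j; apply: unitri_supp.
split=> [->|EA]; first exact: mxle_refl.
exact/mxle_anti/unitri_mulmx_ge.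
Qed.

Lemma mxplus_unitri A : is_unitri A -> is_unitri (mxplus A).
Proof.
move=> uA; have /is_unitriP[A0 A1] := uA.
have PA i j : natle (mxplus A i j) (A i j).
  have /natle_mxplus PA := natle_refl (mxplus A i j).
  by have := PA (unitri_supp j uA) j; rewrite A1 mulr1.
apply/is_unitriP; split=> [i j ji|i].
  by apply/eqP; rewrite -natle0 -(A0 _ _ ji).
apply: natle_anti; rewrite -{1}(A1 i) PA /=.
by apply/natle_mxplus => [|k]; [apply: unitri_supp | rewrite mul1r natle_refl].
Qed.

Lemma mxplus_fix A : is_unitri A -> mxplus A *m A = A.
Proof.
move=> uA; apply/unitri_fix_mxplus => //; first exact: mxplus_unitri.
exact: mxle_refl.
Qed.

(** [A^(+) A^(+)] still fixes [A] on the left, so it cannot exceed [A^(+)]. *)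
Lemma mxplus_idem A : is_unitri A -> mxplus A *m mxplus A = mxplus A.
Proof.
move=> uA; have uP := mxplus_unitri uA.
apply: mxle_anti; last exact: unitri_mulmx_ge.
apply/unitri_fix_mxplus => //; first exact: is_unitriM.
by rewrite -mulmxA !mxplus_fix.
Qed.

Lemma unitri_fix_le E F : is_unitri F -> E *m F = F -> mxle E F.
Proof.
move=> uF <-; rewrite -[X in mxle X _]mulmx1.
exact/mxle_mul2l/unitri_ge1.
Qed.

(** Both equations amount to [E <= A^(+)]; for the second, this uses that
    [A^(+)] is an idempotent above the identity. *)
Lemma mxplus_fixP E A : is_unitri E -> is_unitri A ->
  E *m A = A <-> E *m mxplus A = mxplus A.
Proof.
move=> uE uA; have uP := mxplus_unitri uA.
rewrite unitri_fix_mxplus//; split=> [EP|]; last exact: unitri_fix_le.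
apply: mxle_anti; last exact: unitri_mulmx_ge.
by rewrite -[X in mxle _ X]mxplus_idem//; apply: mxle_mul2r.
Qed.

Lemma antidiagK : involutive (@antidiag S n).
Proof. by move=> A; apply/matrixP => i j; rewrite !mxE !rev_ordK. Qed.

(** The reflection is a transposition followed by a simultaneous reversal of
    rows and columns; it reverses products because [S] is commutative. *)
Lemma antidiagM A B : antidiag (A *m B) = antidiag B *m antidiag A.
Proof.
apply/matrixP => i j; rewrite !mxE (reindex_inj rev_ord_inj) /=.
by apply: eq_bigr => k _; rewrite !mxE mulrC.
Qed.

Lemma antidiag_unitri A : is_unitri A -> is_unitri (antidiag A).
Proof.
move=> /is_unitriP[A0 A1]; apply/is_unitriP; split=> [i j ji|i].
  by rewrite mxE A0//= ltn_sub2l// (leq_ltn_trans ji).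
by rewrite mxE A1.
Qed.

End MatrixOrder.

Section UnitriangularMonoid.
Variables (S : idemSemifieldType) (n : nat).
Implicit Types A B E F : unitri S n.

Definition unitri_plus A : unitri S n := Unitri (mxplus_unitri (valP A)).

Definition unitri_antidiag A : unitri S n := Unitri (antidiag_unitri (valP A)).

Lemma unitri_antidiagK : involutive unitri_antidiag.
Proof. by move=> A; apply/val_inj/antidiagK. Qed.

Lemma unitri_antidiagM A B :
  unitri_antidiag (A * B)%g = (unitri_antidiag B * unitri_antidiag A)%g.
Proof. exact/val_inj/antidiagM. Qed.

Lemma unitri_mulE A B F : (A * B)%g = F <-> A *m B = F :> 'M_n.
Proof. by split=> [<-//|ABF]; apply: val_inj. Qed.

Lemma idem_antidiag E : idem E -> idem (unitri_antidiag E).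
Proof. by rewrite /idem -unitri_antidiagM => ->. Qed.

(** [E |-> unitri_antidiag E] permutes the idempotents and turns right
    identities of [A] into left identities of its reflection. *)
Lemma Ltilde_antidiag A F :
  Rtilde (unitri_antidiag A) (unitri_antidiag F) <-> Ltilde A F.
Proof.
have fixE B E : (unitri_antidiag E * unitri_antidiag B)%g = unitri_antidiag B
    <-> (B * E)%g = B.
  by rewrite -unitri_antidiagM; split=> [/(inv_inj unitri_antidiagK)|->].
split=> AF E /idem_antidiag/AF; first by rewrite !fixE.
by rewrite -!fixE unitri_antidiagK.
Qed.

Lemma unitri_plus_unique A :
  unique (fun F => idem F /\ Rtilde A F) (unitri_plus A).
Proof.
have uA := valP A; split.
  split; first exact/unitri_mulE/mxplus_idem.
  by move=> E _; rewrite !unitri_mulE; apply: mxplus_fixP (valP E) uA.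
move=> F [idF AF]; apply/val_inj/mxle_anti.
  apply: (unitri_fix_le (valP F)); apply/unitri_mulE/AF; apply/unitri_mulE.
    exact: mxplus_idem.
  exact: mxplus_fix.
apply/(unitri_fix_mxplus (valP F) uA)/unitri_mulE.
exact: (AF F idF).2.
Qed.

Lemma unitri_star_unique A :
  unique (fun F => idem F /\ Ltilde A F)
    (unitri_antidiag (unitri_plus (unitri_antidiag A))).
Proof.
have [[idP AP] uniqP] := unitri_plus_unique (unitri_antidiag A); split.
  split; first exact: idem_antidiag.
  by apply/Ltilde_antidiag; rewrite unitri_antidiagK.
move=> F [idF AF]; rewrite -[RHS]unitri_antidiagK; congr unitri_antidiag.
by apply: uniqP; split; [apply: idem_antidiag | apply/Ltilde_antidiag].
Qed.

End UnitriangularMonoid.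

Theorem corollary4p17 (S : idemSemifieldType) (n : nat) (n_ge1 : (1 <= n)%N) :
  @Fountain (unitri S n) /\
  (forall A : unitri S n,
     (exists E : unitri S n,
        unitri_mx E = mxplus (unitri_mx A) /\
        unique (fun F : unitri S n => idem F /\ Rtilde A F) E) /\
     (exists E : unitri S n,
        unitri_mx E = mxstar (unitri_mx A) /\
        unique (fun F : unitri S n => idem F /\ Ltilde A F) E)).
Proof.
split; first split=> A.
- by exists (unitri_plus A); case: (unitri_plus_unique A).
- exists (unitri_antidiag (unitri_plus (unitri_antidiag A))).
  by case: (unitri_star_unique A).
- move=> A; split.
    by exists (unitri_plus A); split=> //; apply: unitri_plus_unique.
  exists (unitri_antidiag (unitri_plus (unitri_antidiag A))).
  by split=> //; apply: unitri_star_unique.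
Qed.
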